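(* Let $\mathcal A$ be a laminar family of partial cuts on $S$, and let $(G,S,c)$ be an inner Eulerian network. Suppose the Eulerian condition is fulfilled by each terminal $s$ for which there exist $(A,B),(A',B')\in\mathcal A$ with $s\notin A\cup B\cup A'\cup B'$ and either ($A\subseteq B'$ and $A'\subseteq B$) or ($B\subseteq A'$ and $B'\subseteq A$). Then there is an integral multiflow locking $\mathcal A$.
   Context: A network $(G,S,c)$: finite digraph $G=(VG,EG)$, terminals $S\subseteq VG$, capacity $c:EG\to\mathbb Z_+$. A multiflow is a set $\mathcal P$ of directed paths joining distinct terminals with $\lambda:\mathcal P\to\mathbb R_+$, $\sum_{P\ni e}\lambda(P)\le c(e)$; integral if $\lambda$ is integer-valued. A node fulfills the Eulerian condition if its outgoing capacity equals its incoming capacity; the network is inner Eulerian if every non-terminal node does. A partial cut on $S$ is an ordered pair $(A,B)$ of disjoint subsets of $S$; an $(A,B)$-flow is a multiflow whose paths go from a node of $A$ to a node of $B$ (its value is the total $\lambda$), and a maximum $(A,B)$-flow is a multiflow maximizing $\sum_P\lambda(P)\delta_{A,B}(s_P,t_P)$, where $\delta_{A,B}(s,t)=1$ if $(s,t)\in A\times B$ and $0$ otherwise. A multiflow locks $\mathcal A$ if it is simultaneously a maximum $(A,B)$-flow for every $(A,B)\in\mathcal A$. Two partial cuts $(A,B),(A',B')$ are laminar if $A\subseteq A',B\supseteq B'$, or $A\subseteq B',B\supseteq A'$, or $A\supseteq A',B\subseteq B'$, or $A\supseteq B',B\subseteq A'$; a family is laminar if every pair is. *)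

(* Defs.v *)
From HB Require Import structures.
From mathcomp Require Import all_boot all_order all_algebra.
From mathcomp Require Import finmap reals.

Set Implicit Arguments.
Unset Strict Implicit.
Unset Printing Implicit Defensive.

Import Order.TTheory GRing.Theory Num.Theory.
Local Open Scope ring_scope.

(* Parallel edges and loops are allowed; a digraph given by a set of ordered
   pairs of nodes is the case where [e |-> (src e, tgt e)] is injective. *)
Record network := Network {
  node : finType;
  edge : finType;
  src : edge -> node;
  tgt : edge -> node;
  terminals : {set node};
  capacity : edge -> nat
}.

Arguments src {n} e.
Arguments tgt {n} e.

Definition eulerian_at (N : network) (v : node N) : Prop :=
  (\sum_(e : edge N | src e == v) capacity e =
   \sum_(e : edge N | tgt e == v) capacity e)%N.

Definition inner_eulerian (N : network) : Prop :=
  forall v : node N, v \notin terminals N -> eulerian_at v.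

(* A path is given by its first node and its sequence of edges; recording the
   first node makes both endpoints total functions. *)
Definition npath (N : network) := (node N * seq (edge N))%type.

Definition path_start (N : network) (P : npath N) : node N := P.1.
Definition path_end (N : network) (P : npath N) : node N :=
  last P.1 [seq tgt e | e <- P.2].

Fixpoint walk (N : network) (x : node N) (p : seq (edge N)) : bool :=
  if p is e :: p' then (src e == x) && walk (tgt e) p' else true.

Definition is_dipath (N : network) (P : npath N) : bool :=
  walk P.1 P.2 && uniq (P.1 :: [seq tgt e | e <- P.2]).

(* Terminals may also occur as interior nodes of the path. *)
Definition joins_terminals (N : network) (P : npath N) : bool :=
  [&& is_dipath P, path_start P \in terminals N,
      path_end P \in terminals N & path_start P != path_end P].

(* Only the values of [flow_val] on [flow_paths] are meaningful. *)
Record multiflow (R : realType) (N : network) := Multiflow {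
  flow_paths : {fset npath N};
  flow_val : npath N -> R;
  flow_pathsP : forall P, P \in flow_paths -> joins_terminals P;
  flow_val_ge0 : forall P, P \in flow_paths -> 0 <= flow_val P;
  flow_capacity : forall e : edge N,
    \sum_(P <- flow_paths | e \in P.2) flow_val P <= (capacity e)%:R
}.

Definition integral (R : realType) (N : network) (f : multiflow R N) : Prop :=
  forall P, P \in flow_paths f -> flow_val f P \is a Num.int.

Definition cut_pair (N : network) := ({set node N} * {set node N})%type.

Definition partial_cut (N : network) (X : cut_pair N) : Prop :=
  [/\ X.1 \subset terminals N, X.2 \subset terminals N & [disjoint X.1 & X.2]].

Definition delta (N : network) (X : cut_pair N) (s t : node N) : nat :=
  if (s \in X.1) && (t \in X.2) then 1 else 0.

Definition cut_value (R : realType) (N : network) (X : cut_pair N)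
    (f : multiflow R N) : R :=
  \sum_(P <- flow_paths f)
    flow_val f P * (delta X (path_start P) (path_end P))%:R.

Definition maximum_flow (R : realType) (N : network) (X : cut_pair N)
    (f : multiflow R N) : Prop :=
  forall g : multiflow R N, cut_value X g <= cut_value X f.

Definition locks (R : realType) (N : network) (f : multiflow R N)
    (F : {set cut_pair N}) : Prop :=
  forall X, X \in F -> maximum_flow X f.

Definition laminar (N : network) (X Y : cut_pair N) : Prop :=
  [\/ X.1 \subset Y.1 /\ Y.2 \subset X.2,
      X.1 \subset Y.2 /\ Y.1 \subset X.2,
      Y.1 \subset X.1 /\ X.2 \subset Y.2
    | Y.2 \subset X.1 /\ X.2 \subset Y.1].

Definition laminar_family (N : network) (F : {set cut_pair N}) : Prop :=
  forall X Y, X \in F -> Y \in F -> laminar X Y.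

(* Main.v *)
(** Split off arcs in Lovasz's manner: replace two arcs u -> v -> w by one arc
    u -> w, as long as no value of a minimum (A, B)-cut with (A, B) in the family
    drops; splitting preserves all differences of out- and in-degrees.  A pair
    u, v, w that cannot be split is blocked by a tight set U of some (A, B), with
    u and w on one side of U and v on the other.  Tight sets of laminar cuts
    uncross: submodularly in the nested cases, posimodularly in the two facing
    cases, where the nodes of the relevant intersection (or of its dual, the
    complement of the union) are Eulerian by hypothesis.  Hence, for a fixed
    arc at v, the blocking sides avoiding v are closed under union, and the largest one
    could be enlarged by v unless v is in B (if the side is U) or in A (if it is
    the complement).  Uncrossing this set with a tight set U of an arbitrary
    (A, B) in the family shows that, when nothing can be split any more, every
    arc leaving U goes from A to B.  So the arcs that remain, each standing for a walk
    in the network, attain all the minimum cuts simultaneously. *)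

Require Import Defs.
From HB Require Import structures.
From mathcomp Require Import all_boot all_order all_algebra.
From mathcomp Require Import finmap boolp reals zify.

Set Implicit Arguments.
Unset Strict Implicit.
Unset Printing Implicit Defensive.

Import Order.TTheory GRing.Theory Num.Theory.

(** * Cut identities for lists of arcs *)

Section Arcs.
Context {V : finType}.
Implicit Types (E : seq (V * V)) (U W Q : {set V}) (u v w : V) (p : V * V).

Definition leaves U p := (p.1 \in U) && (p.2 \notin U).
Definition outdeg E U := count (leaves U) E.
Definition balanced E v :=
  count (fun p => p.1 == v) E == count (fun p => p.2 == v) E.

Definition separates (X : {set V} * {set V}) U :=
  [forall x, ((x \in X.1) ==> (x \in U)) && ((x \in X.2) ==> (x \notin U))].

Lemma count_fiber (f : V * V -> V) E Q :
  count (fun p => f p \in Q) E =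
  (\sum_(v in Q) count (fun p => f p == v) E)%N.
Proof.
elim: E => [|p E IHE] /=; first by rewrite big1.
rewrite IHE big_split /=; congr addn.
case: (boolP (f p \in Q)) => fpQ.
  rewrite (bigD1 (f p)) //= eqxx big1 // => v /andP[_ /negPf].
  by rewrite eq_sym => ->.
by rewrite big1 // => v vQ; case: eqP => // fpv; rewrite fpv vQ in fpQ.
Qed.

Lemma balanced_set E Q : (forall v, v \in Q -> balanced E v) ->
  count (fun p => p.1 \in Q) E = count (fun p => p.2 \in Q) E.
Proof.
move=> bQ; rewrite (count_fiber fst) (count_fiber snd).
by apply: eq_bigr => v /bQ /eqP.
Qed.

Definition between U W p :=
  (p.1 \in U) && (p.2 \in W) || (p.1 \in W) && (p.2 \in U).

(** Checked arc by arc. The count of arcs between the two differences is kept because it must vanish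
    when both sets are tight. *)
Lemma outdeg_submod E U W :
  (outdeg E U + outdeg E W = outdeg E (U :&: W) + outdeg E (U :|: W)
    + count (between (U :\: W) (W :\: U)) E)%N.
Proof.
rewrite /outdeg; elim: E => //= p E IHE.
have: (leaves U p + leaves W p = leaves (U :&: W) p + leaves (U :|: W) p
        + between (U :\: W) (W :\: U) p)%N.
  rewrite /leaves /between !inE.
  by case: (p.1 \in U); case: (p.1 \in W); case: (p.2 \in U); case: (p.2 \in W).
lia.
Qed.

(** Written without subtraction: the head and tail counts over [U :&: W] cancel once all nodes there
    are balanced. *)
Lemma outdeg_posimod E U W :
  (outdeg E U + outdeg E W + count (fun p => p.2 \in U :&: W) E =
   outdeg E (U :\: W) + outdeg E (W :\: U)
    + count (fun p => p.1 \in U :&: W) E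
    + count (between (U :&: W) (~: (U :|: W))) E)%N.
Proof.
rewrite /outdeg; elim: E => //= p E IHE.
have: (leaves U p + leaves W p + (p.2 \in U :&: W) =
       leaves (U :\: W) p + leaves (W :\: U) p + (p.1 \in U :&: W)
        + between (U :&: W) (~: (U :|: W)) p)%N.
  rewrite /leaves /between !inE.
  by case: (p.1 \in U); case: (p.1 \in W); case: (p.2 \in U); case: (p.2 \in W).
lia.
Qed.

(** This is [outdeg_posimod] for the complements of [U] and [W] with all arcs reversed. *)
Lemma outdeg_posimodC E U W :
  (outdeg E U + outdeg E W + count (fun p => p.1 \in ~: (U :|: W)) E =
   outdeg E (U :|: ~: W) + outdeg E (W :|: ~: U)
    + count (fun p => p.2 \in ~: (U :|: W)) E
    + count (between (U :&: W) (~: (U :|: W))) E)%N.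
Proof.
rewrite /outdeg; elim: E => //= p E IHE.
have: (leaves U p + leaves W p + (p.1 \in ~: (U :|: W)) =
       leaves (U :|: ~: W) p + leaves (W :|: ~: U) p + (p.2 \in ~: (U :|: W))
        + between (U :&: W) (~: (U :|: W)) p)%N.
  rewrite /leaves /between !inE.
  by case: (p.1 \in U); case: (p.1 \in W); case: (p.2 \in U); case: (p.2 \in W).
lia.
Qed.

Lemma outdeg_setU1 E U v : v \notin U ->
  (outdeg E (v |: U) + count (fun p => (p.1 \in U) && (p.2 == v)) E =
   outdeg E U + count (fun p => (p.1 == v) && (p.2 \notin v |: U)) E)%N.
Proof.
move=> vU; rewrite /outdeg; elim: E => //= p E IHE.
have: (leaves (v |: U) p + ((p.1 \in U) && (p.2 == v)) =
       leaves U p + ((p.1 == v) && (p.2 \notin v |: U)))%N.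
  rewrite /leaves !inE; have [->|] := eqVneq p.1 v; have [->|] := eqVneq p.2 v;
    rewrite ?(negPf vU) //=; case: (p.1 \in U); case: (p.2 \in U) => //.
lia.
Qed.

(** Wherever [lam X] bounds the out-degree of all separating sets from below, a tight set is a
    minimum cut. *)
Definition tight E lam X U := separates X U && (outdeg E U == lam X).

Lemma count_eq0_in (a : pred (V * V)) E p : count a E = 0 -> p \in E -> ~~ a p.
Proof.
move=> E0 pE; apply/negP => ap; have: has a E by apply/hasP; exists p.
by rewrite has_count E0.
Qed.

End Arcs.

(** Decides membership of one point by truth table, after instantiating every inclusion and
    separation hypothesis at it. *)
Ltac set_bash x := repeat match goal with
  | H : is_true (separates _ _) |- _ => move/forallP/(_ x): H
  | H : is_true (_ \subset _) |- _ => move/subsetP/(_ x): H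
  end; rewrite ?inE /=; repeat match goal with
  | |- context [x \in ?A] => case: (x \in A)
  end; do ?[move=> /(_ isT) | by [] | move=> _ | by move=> /(_ isT)].

(** * Uncrossing tight sets *)

Section Uncrossing.
Context {V : finType} (E : seq (V * V)) (F : {set {set V} * {set V}})
  (lam : {set V} * {set V} -> nat).
Hypothesis lamP : forall X U, X \in F -> separates X U -> (lam X <= outdeg E U)%N.
Implicit Types (X Y : {set V} * {set V}) (U W : {set V}).

(** The intersection separates [X] and the union separates [Y], so both lower bounds apply.
    Submodularity then makes them equalities and leaves no room for the defect term. *)
Lemma tight_nested X Y U W : X \in F -> Y \in F ->
  X.1 \subset Y.1 -> Y.2 \subset X.2 -> tight E lam X U -> tight E lam Y W ->
  [/\ tight E lam X (U :&: W), tight E lam Y (U :|: W)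
    & forall p, p \in E -> ~~ between (U :\: W) (W :\: U) p].
Proof.
move=> XF YF s1 s2 /andP[XU /eqP dU] /andP[YW /eqP dW].
have sI : separates X (U :&: W) by apply/forallP => x; set_bash x.
have sU : separates Y (U :|: W) by apply/forallP => x; set_bash x.
have := outdeg_submod E U W; have := lamP XF sI; have := lamP YF sU.
rewrite /tight sI sU /= dU dW => h1 h2 h3; split; [lia|lia|].
by move=> p pE; apply: count_eq0_in pE; lia.
Qed.

Section Facing.
Context (X Y : {set V} * {set V}).
Hypotheses (XF : X \in F) (YF : Y \in F).
Hypothesis bal : forall v, v \notin X.1 :|: X.2 :|: Y.1 :|: Y.2 -> balanced E v.

(** A node of [U :&: W] lies in neither [X.2] nor [Y.2], hence by the inclusions in none of the four
    sides, and is balanced. *)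
Lemma tight_facing U W : X.1 \subset Y.2 -> Y.1 \subset X.2 ->
  tight E lam X U -> tight E lam Y W ->
  [/\ tight E lam X (U :\: W), tight E lam Y (W :\: U)
    & forall p, p \in E -> ~~ between (U :&: W) (~: (U :|: W)) p].
Proof.
move=> s1 s2 /andP[XU /eqP dU] /andP[YW /eqP dW].
have sX : separates X (U :\: W) by apply/forallP => x; set_bash x.
have sY : separates Y (W :\: U) by apply/forallP => x; set_bash x.
have bQ : forall v, v \in U :&: W -> balanced E v.
  by move=> v vQ; apply: bal; move: vQ; set_bash v.
have := outdeg_posimod E U W; have := lamP XF sX; have := lamP YF sY.
rewrite /tight sX sY /= dU dW (balanced_set bQ) => h1 h2 h3; split; [lia|lia|].
by move=> p pE; apply: count_eq0_in pE; lia.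
Qed.

(** Dually, the nodes outside [U :|: W] lie in none of the four sides. *)
Lemma tight_facingC U W : X.2 \subset Y.1 -> Y.2 \subset X.1 ->
  tight E lam X U -> tight E lam Y W ->
  [/\ tight E lam X (U :|: ~: W), tight E lam Y (W :|: ~: U)
    & forall p, p \in E -> ~~ between (U :&: W) (~: (U :|: W)) p].
Proof.
move=> s1 s2 /andP[XU /eqP dU] /andP[YW /eqP dW].
have sX : separates X (U :|: ~: W) by apply/forallP => x; set_bash x.
have sY : separates Y (W :|: ~: U) by apply/forallP => x; set_bash x.
have bQ : forall v, v \in ~: (U :|: W) -> balanced E v.
  by move=> v vQ; apply: bal; move: vQ; set_bash v.
have := outdeg_posimodC E U W; have := lamP XF sX; have := lamP YF sY.
rewrite /tight sX sY /= dU dW (balanced_set bQ) => h1 h2 h3; split; [lia|lia|].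
by move=> p pE; apply: count_eq0_in pE; lia.
Qed.
End Facing.
End Uncrossing.

(** * Arc lists in which nothing can be split off *)

Section Unsplittable.
Context {V : finType} (E : seq (V * V)) (F : {set {set V} * {set V}})
  (lam : {set V} * {set V} -> nat).
Hypothesis lamP : forall X U, X \in F -> separates X U -> (lam X <= outdeg E U)%N.
Hypothesis lamF : forall X Y, X \in F -> Y \in F ->
  [\/ X.1 \subset Y.1 /\ Y.2 \subset X.2, X.1 \subset Y.2 /\ Y.1 \subset X.2,
      Y.1 \subset X.1 /\ X.2 \subset Y.2 | Y.2 \subset X.1 /\ X.2 \subset Y.1].
Hypothesis balF : forall X Y v, X \in F -> Y \in F ->
  X.1 \subset Y.2 /\ Y.1 \subset X.2 \/ X.2 \subset Y.1 /\ Y.2 \subset X.1 ->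
  v \notin X.1 :|: X.2 :|: Y.1 :|: Y.2 -> balanced E v.
Hypothesis unsplittable : forall u v w, (u, v) \in E -> (v, w) \in E ->
  exists X U, [/\ X \in F, tight E lam X U
    & [&& u \in U, w \in U & v \notin U] || [&& u \notin U, w \notin U & v \in U]].
Implicit Types (X Y : {set V} * {set V}) (U W Z : {set V}) (u v w : V) (p : V * V).

(** Orientation is dropped because blockers are anchored to an entering arc of [v] in one case and
    to a leaving arc in the other. *)
Definition adjacent u v := ((u, v) \in E) || ((v, u) \in E).

Lemma adjacent_between u v U W : adjacent u v ->
  (forall p, p \in E -> ~~ between U W p) -> ~~ between U W (u, v).
Proof.
move=> /orP[uv|vu] /(_ _ _) nb; first exact: nb.
by move: (nb _ vu); rewrite /between /= orbC andbC [X in _ || X]andbC.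
Qed.

(** One alternative per case of laminarity. An adjacent pair placed across [U] and [W] rules out
    either the nested or the facing alternatives. *)
Definition uncrossed X Y U W := [\/
  [/\ X.1 \subset Y.1, Y.2 \subset X.2, tight E lam X (U :&: W),
      tight E lam Y (U :|: W)
    & forall u v, adjacent u v -> ~~ between (U :\: W) (W :\: U) (u, v)],
  [/\ Y.1 \subset X.1, X.2 \subset Y.2, tight E lam Y (U :&: W),
      tight E lam X (U :|: W)
    & forall u v, adjacent u v -> ~~ between (U :\: W) (W :\: U) (u, v)],
  [/\ X.1 \subset Y.2, Y.1 \subset X.2, tight E lam X (U :\: W),
      tight E lam Y (W :\: U)
    & forall u v, adjacent u v -> ~~ between (U :&: W) (~: (U :|: W)) (u, v)]
| [/\ X.2 \subset Y.1, Y.2 \subset X.1, tight E lam X (U :|: ~: W),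
      tight E lam Y (W :|: ~: U)
    & forall u v, adjacent u v -> ~~ between (U :&: W) (~: (U :|: W)) (u, v)]].

Lemma tight_uncross X Y U W : X \in F -> Y \in F ->
  tight E lam X U -> tight E lam Y W -> uncrossed X Y U W.
Proof.
move=> XF YF tU tW; case: (lamF XF YF) => -[s1 s2].
- have [tI tJ nb] := tight_nested lamP XF YF s1 s2 tU tW.
  by constructor 1; split=> // u v uv; exact: adjacent_between nb.
- have bal v := @balF X Y v XF YF (or_introl (conj s1 s2)).
  have [tI tJ nb] := tight_facing lamP XF YF bal s1 s2 tU tW.
  by constructor 3; split=> // u v uv; exact: adjacent_between nb.
- have [tI tJ nb] := tight_nested lamP YF XF s1 s2 tW tU.
  rewrite setIC in tI; rewrite setUC in tJ.
  constructor 2; split=> // u v uv.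
  by move: (adjacent_between uv nb); rewrite /between orbC.
- have bal v := @balF X Y v XF YF (or_intror (conj s2 s1)).
  have [tI tJ nb] := tight_facingC lamP XF YF bal s2 s1 tU tW.
  by constructor 4; split=> // u v uv; exact: adjacent_between nb.
Qed.

(* [Z] is the [A]-side of a tight cut or, when [~: Z] is tight, its [B]-side. *)
Definition blocker u v Z := [/\ u \in Z, v \notin Z
  & exists X, X \in F /\ (tight E lam X Z \/ tight E lam X (~: Z))].

(** If both sets are tight, or both complements are, the pair [u], [v] excludes the facing
    alternatives; if they are of different kinds, it excludes the nested ones. Each surviving
    alternative makes the union or its complement tight. *)
Lemma blockerU u v Z1 Z2 : adjacent u v ->
  blocker u v Z1 -> blocker u v Z2 -> blocker u v (Z1 :|: Z2).
Proof.
move=> uv [uZ1 vZ1 [X [XF tX]]] [uZ2 vZ2 [Y [YF tY]]].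
split; [by rewrite inE uZ1|by rewrite inE negb_or vZ1|].
case: tX => tX; case: tY => tY.
- case: (tight_uncross XF YF tX tY) => -[_ _ t1 t2 /(_ _ _ uv)];
    rewrite /between !inE /= uZ1 uZ2 (negPf vZ1) (negPf vZ2) //= => _.
    by exists Y; split=> //; left.
  by exists X; split=> //; left.
- case: (tight_uncross XF YF tX tY) => -[_ _ t1 t2 /(_ _ _ uv)];
    rewrite /between !inE /= uZ1 uZ2 (negPf vZ1) (negPf vZ2) //= => _.
    by exists Y; split=> //; right; rewrite setCU setIC -setDE.
  by exists X; split=> //; left; rewrite -[Z2]setCK.
- case: (tight_uncross XF YF tX tY) => -[_ _ t1 t2 /(_ _ _ uv)];
    rewrite /between !inE /= uZ1 uZ2 (negPf vZ1) (negPf vZ2) //= => _.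
    by exists X; split=> //; right; rewrite setCU -setDE.
  by exists Y; split=> //; left; rewrite setUC -[Z1]setCK.
- case: (tight_uncross XF YF tX tY) => -[_ _ t1 t2 /(_ _ _ uv)];
    rewrite /between !inE /= uZ1 uZ2 (negPf vZ1) (negPf vZ2) //= => _.
    by exists X; split=> //; right; rewrite setCU.
  by exists Y; split=> //; right; rewrite setCU.
Qed.

Lemma common_blocker u v (s : seq V) : adjacent u v -> s != [::] ->
  (forall w, w \in s -> exists Z, blocker u v Z /\ w \in Z) ->
  exists Z, blocker u v Z /\ {subset s <= Z}.
Proof.
move=> uv; elim: s => // w s IHs _ bs.
have [Z1 [b1 wZ1]] := bs w (mem_head w s).
have [->|s0] := eqVneq s [::].
  by exists Z1; split=> // x; rewrite inE => /eqP->.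
have [x xs|Z2 [b2 sZ2]] := IHs s0; first by apply: bs; rewrite inE xs orbT.
exists (Z1 :|: Z2); split; first exact: blockerU.
by move=> x; rewrite !inE => /predU1P[->|/sZ2->]; rewrite ?wZ1 ?orbT.
Qed.

(** The side of the blocking cut without [v] holds both [u] and [w], so it serves whichever arc is
    kept fixed. *)
Lemma blockerP u v w : (u, v) \in E -> (v, w) \in E ->
  exists Z, [/\ blocker u v Z, blocker w v Z & w \in Z].
Proof.
move=> uv vw; have [X [U [XF tU]]] := unsplittable uv vw.
case/orP=> /and3P[uU wU vU].
  by exists U; split=> //; split=> //; exists X; split=> //; left.
by exists (~: U); split; rewrite /blocker ?setCK ?inE ?negbK //; split=> //;
  exists X; split=> //; right.
Qed.

(** Adding [v] to a minimum cut still separates [X], so the arcs gained are at least as many as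
    those lost. *)
Lemma outdeg_addv X U v : X \in F -> tight E lam X U -> v \notin X.2 ->
  v \notin U ->
  (count (fun p => (p.1 \in U) && (p.2 == v)) E <=
   count (fun p => (p.1 == v) && (p.2 \notin v |: U)) E)%N.
Proof.
move=> XF /andP[sU /eqP dU] vX vU.
have sep : separates X (v |: U).
  apply/forallP => x; move/forallP/(_ x): sU; rewrite !inE.
  by have [->|_] := eqVneq x v; rewrite //= ?(negPf vX) ?implybT.
by have := outdeg_setU1 E vU; have := lamP XF sep; lia.
Qed.

Lemma outdeg_delv X U v : X \in F -> tight E lam X U -> v \notin X.1 ->
  v \in U ->
  (count (fun p => (p.1 == v) && (p.2 \notin U)) E <=
   count (fun p => (p.1 \in U :\ v) && (p.2 == v)) E)%N.
Proof.
move=> XF /andP[sU /eqP dU] vX vU.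
have sep : separates X (U :\ v).
  apply/forallP => x; move/forallP/(_ x): sU; rewrite !inE.
  by have [->|_] := eqVneq x v; rewrite //= ?(negPf vX) ?implybT.
have vUv : v \notin U :\ v by rewrite !inE eqxx.
have := outdeg_setU1 E vUv; rewrite setD1K //; have := lamP XF sep; lia.
Qed.

Lemma count_gt0_in (a : pred (V * V)) p : p \in E -> a p -> (0 < count a E)%N.
Proof. by move=> pE ap; rewrite -has_count; apply/hasP; exists p. Qed.

(** Used with [b] selecting one known arc, to make a comparison of degrees strict. *)
Lemma count_disjoint (a b c : pred (V * V)) :
  (forall p, p \in E -> a p + b p <= c p)%N ->
  (count a E + count b E <= count c E)%N.
Proof.
elim: E => //= p E' IHE abc; have := abc p (mem_head _ _).
have := IHE (fun q qE => abc q (mem_behead (s := p :: E') qE)); lia.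
Qed.

(* When the in-degree of [v] is at most its out-degree, keep the incoming arc
   fixed: adding [v] to a [B]-side containing all its out-neighbours then
   decreases the cut.  Otherwise keep the outgoing arc fixed: adding [v] to an
   [A]-side containing all its in-neighbours does. *)
Lemma unsplittable_end u v w : (u, v) \in E -> (v, w) \in E ->
  exists X U, [/\ X \in F, tight E lam X U
    & [&& u \in U, w \in U, v \notin U & v \in X.2]
      || [&& u \notin U, w \notin U, v \in U & v \in X.1]].
Proof.
move=> uv vw.
case: (leqP (count (fun p => p.2 == v) E) (count (fun p => p.1 == v) E)) => deg.
- have wS : w \in [seq p.2 | p <- E & p.1 == v].
    by apply/mapP; exists (v, w) => //; rewrite mem_filter eqxx.
  have [||x|Z [[uZ vZ [X [XF tX]]] sZ]] :=
      @common_blocker u v [seq p.2 | p <- E & p.1 == v].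
  + by rewrite /adjacent uv.
  + by apply: contraL wS => /eqP ->.
  + case/mapP => -[v' x']; rewrite mem_filter /= => /andP[/eqP-> vx'] ->.
    by have [Z [bZ _ xZ]] := blockerP uv vx'; exists Z.
  have outZ p : p \in E -> p.1 == v -> p.2 \in Z.
    by move=> pE pv; apply: sZ; apply: map_f; rewrite mem_filter pv.
  case: tX => tX.
    exists X, Z; split=> //; rewrite uZ (sZ _ wS) vZ orbF /=.
    (* All arcs out of [v] end in [Z], so adding [v] removes [(u, v)] from the cut and brings in no
       arc, whatever the degrees. *)
    apply/negPn/negP => vX; have := outdeg_addv XF tX vX vZ.
    apply/negP; rewrite -ltnNge.
    have ->: count (fun p => (p.1 == v) && (p.2 \notin v |: Z)) E = 0.
      apply/eqP; rewrite -leqn0 leqNgt -has_count; apply/hasPn => p pE /=.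
      by case: eqVneq => //= /eqP/(outZ p pE); rewrite !inE => ->; rewrite orbT.
    by apply: (count_gt0_in uv); rewrite /= uZ eqxx.
  have vU : v \in ~: Z by rewrite inE.
  exists X, (~: Z); split=> //; rewrite !inE uZ (sZ _ wS) vZ /=.
  apply/negPn/negP => vX; have := outdeg_delv XF tX vX vU.
  have ->: count (fun p => (p.1 == v) && (p.2 \notin ~: Z)) E =
           count (fun p => p.1 == v) E.
    apply: eq_in_count => p pE /=; rewrite inE negbK.
    by case: (boolP (p.1 == v)) => // /(outZ p pE) ->.
  (* The arc [(u, v)] enters [v] from [Z]; leaving it out of the count forces the out-degree of [v]
     strictly below its in-degree, against [deg]. *)
  have : (count (fun p => (p.1 \in ~: Z :\ v) && (p.2 == v)) E +
          count (fun p => p == (u, v)) E <= count (fun p => p.2 == v) E)%N.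
    apply: count_disjoint => -[x y] _ /=; rewrite !inE xpair_eqE.
    have [->|_] := eqVneq x u; rewrite ?uZ /= ?andbF; first by case: eqP.
    by case: (y == v); rewrite ?andbT ?andbF //; case: (_ && _).
  have : (0 < count (fun p => p == (u, v)) E)%N by apply: (count_gt0_in uv).
  lia.
- have uS : u \in [seq p.1 | p <- E & p.2 == v].
    by apply/mapP; exists (u, v) => //; rewrite mem_filter eqxx.
  have [||x|Z [[wZ vZ [X [XF tX]]] sZ]] :=
      @common_blocker w v [seq p.1 | p <- E & p.2 == v].
  + by rewrite /adjacent vw orbT.
  + by apply: contraL uS => /eqP ->.
  + case/mapP => -[x' v']; rewrite mem_filter /= => /andP[/eqP-> vx'] ->.
    by have [Z [[xZ _ _] bZ _]] := blockerP vx' vw; exists Z.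
  have inZ p : p \in E -> p.2 == v -> p.1 \in Z.
    by move=> pE pv; apply: sZ; apply: map_f; rewrite mem_filter pv.
  case: tX => tX.
    exists X, Z; split=> //; rewrite wZ (sZ _ uS) vZ orbF /=.
    apply/negPn/negP => vX; have := outdeg_addv XF tX vX vZ.
    have ->: count (fun p => (p.1 \in Z) && (p.2 == v)) E =
             count (fun p => p.2 == v) E.
      apply: eq_in_count => p pE /=; rewrite andbC.
      by case: (boolP (p.2 == v)) => // /(inZ p pE) ->.
    have : (count (fun p => (p.1 == v) && (p.2 \notin v |: Z)) E +
            count (fun p => p == (v, w)) E <= count (fun p => p.1 == v) E)%N.
      apply: count_disjoint => -[x y] _ /=; rewrite !inE xpair_eqE.
      have [->|_] := eqVneq y w; rewrite ?wZ ?orbT /= ?andbF ?andbT.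
        by case: eqP.
      by case: (x == v); case: (~~ _).
    have : (0 < count (fun p => p == (v, w)) E)%N by apply: (count_gt0_in vw).
    lia.
  have vU : v \in ~: Z by rewrite inE.
  exists X, (~: Z); split=> //; rewrite !inE wZ (sZ _ uS) vZ /=.
  apply/negPn/negP => vX; have := outdeg_delv XF tX vX vU.
  apply/negP; rewrite -ltnNge.
  have ->: count (fun p => (p.1 \in ~: Z :\ v) && (p.2 == v)) E = 0.
    apply/eqP; rewrite -leqn0 leqNgt -has_count; apply/hasPn => p pE /=.
    rewrite andbC !inE; case: eqVneq => //= /eqP/(inZ p pE) ->.
    by rewrite andbF.
  by apply: (count_gt0_in vw); rewrite /= !inE wZ eqxx.
Qed.

(** Otherwise some arc [(u, v)] starts inside a minimal tight set. Uncrossing with a cut from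
    [unsplittable_end] then either puts [v] in [X.1] by inclusion of sides or yields a smaller tight
    set without [u]. *)
Lemma tight_source X U v y : X \in F -> tight E lam X U -> v \in U ->
  y \notin U -> (v, y) \in E -> v \in X.1.
Proof.
move=> XF tU vU yU vy; apply/negPn/negP => vX.
(* A minimal tight set keeping [v] and avoiding [y] cannot be uncrossed further. *)
pose P W := [&& tight E lam X W, v \in W & y \notin W].
have [|U0 /minsetP[/and3P[tU0 vU0 yU0] minU0] _] := @minset_exists _ P U.
  by rewrite /P tU vU.
(* As [v] is not in [X.1], removing it keeps separation; the lost arc [(v, y)] must be made up for
   by an arc into [v] from within [U0]. *)
have [u uv uU0] : exists2 u, (u, v) \in E & u \in U0.
  have := outdeg_delv XF tU0 vX vU0.
  have: (0 < count (fun p => (p.1 == v) && (p.2 \notin U0)) E)%N.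
    by apply: (count_gt0_in vy); rewrite /= eqxx.
  move=> h1 h2; have := leq_trans h1 h2; rewrite -has_count.
  case/hasP => -[x y'] xy /= /andP[]; rewrite !inE => /andP[_ xU0] /eqP yv.
  by exists x; rewrite // -yv.
have minE W : W \subset U0 -> P W -> u \in W.
  by move=> sW PW; rewrite (minU0 W).
have avy : adjacent v y by rewrite /adjacent vy.
have [Y [W [YF tW]]] := unsplittable_end uv vy.
case/orP => /and4P[uW yW vW vY];
  case: (tight_uncross XF YF tU0 tW) =>
    -[/subsetP/(_ v) s1 /subsetP/(_ v) s2 t1 _ /(_ _ _ avy)];
  rewrite /between !inE /= ?(negPf yU0) ?(negPf vW) ?vU0 ?vW ?yW ?(negPf yW) //=.
- move=> _; have: u \in U0 :\: W; last by rewrite inE uW.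
  by apply: minE; rewrite ?subsetDl // /P t1 !inE vU0 vW (negPf yU0) andbF.
- by rewrite s2 in vX.
- move=> _; have: u \in U0 :&: W; last by rewrite inE (negPf uW) andbF.
  by apply: minE; rewrite ?subsetIl // /P t1 !inE vU0 vW (negPf yU0).
- by rewrite s1 in vX.
Qed.

(** The mirror argument: a maximal tight set, an arc from [v] to some [w] outside it, and a larger
    tight set containing [w]. *)
Lemma tight_sink X U x v : X \in F -> tight E lam X U -> x \in U ->
  v \notin U -> (x, v) \in E -> v \in X.2.
Proof.
move=> XF tU xU vU xv; apply/negPn/negP => vX.
pose P W := [&& tight E lam X W, x \in W & v \notin W].
have [|U0 /maxsetP[/and3P[tU0 xU0 vU0] maxU0] _] := @maxset_exists _ P U.
  by rewrite /P tU xU.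
have [w vw wU0] : exists2 w, (v, w) \in E & w \notin U0.
  have := outdeg_addv XF tU0 vX vU0.
  have: (0 < count (fun p => (p.1 \in U0) && (p.2 == v)) E)%N.
    by apply: (count_gt0_in xv); rewrite /= eqxx xU0.
  move=> h1 h2; have := leq_trans h1 h2; rewrite -has_count.
  case/hasP => -[v' w] vw /= /andP[]; rewrite !inE negb_or.
  by move=> /eqP <- /andP[_ wU0]; exists w.
have maxE W : U0 \subset W -> P W -> w \notin W.
  by move=> sW PW; rewrite (maxU0 W).
have axv : adjacent x v by rewrite /adjacent xv.
have [Y [W [YF tW]]] := unsplittable_end xv vw.
case/orP => /and4P[xW wW vW vY];
  case: (tight_uncross XF YF tU0 tW) =>
    -[/subsetP/(_ v) s1 /subsetP/(_ v) s2 t1 t2 /(_ _ _ axv)];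
  rewrite /between !inE /= ?(negPf vU0) ?(negPf vW) ?xU0 ?xW ?vW ?(negPf xW) //=.
- by rewrite s2 in vX.
- move=> _; have: w \notin U0 :|: W; last by rewrite inE wW orbT.
  by apply: maxE; rewrite ?subsetUl // /P t2 !inE xU0 negb_or vU0.
- by rewrite s2 in vX.
- move=> _; have: w \notin U0 :|: ~: W; last by rewrite !inE (negPf wW) orbT.
  by apply: maxE; rewrite ?subsetUl // /P t1 !inE xU0 negb_or vU0 vW.
Qed.

End Unsplittable.

(** * Walks and their shortening to simple paths *)

Section Walks.
Context {N : network}.
Implicit Types (P Q : npath N) (L : seq (npath N)) (x y : node N) (e : edge N)
  (p q : seq (edge N)) (U : {set node N}) (X : cut_pair N).

Lemma walk_cat x p q :
  walk x (p ++ q) = walk x p && walk (last x [seq tgt e | e <- p]) q.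
Proof. by elim: p x => //= e p IHp x; rewrite IHp andbA. Qed.

Lemma simple_walk_suffix x y q : walk y q -> uniq (y :: [seq tgt e | e <- q]) ->
  x \in y :: [seq tgt e | e <- q] -> exists q', [/\ walk x q',
    uniq (x :: [seq tgt e | e <- q']),
    last x [seq tgt e | e <- q'] = last y [seq tgt e | e <- q]
  & {subset q' <= q}].
Proof.
elim: q y => [|e q IHq] y wq uq.
  by rewrite inE => /eqP->; exists [::].
rewrite in_cons => /predU1P[->|xq]; first by exists (e :: q); split.
move: wq uq => /= /andP[_ wq] /andP[_ uq].
have [q' [wq' uq' lq' sq']] := IHq _ wq uq xq.
by exists q'; split=> // e' /sq'; rewrite inE => ->; rewrite orbT.
Qed.

(** Shorten the tail first; if it visits [x] again, keep only its part from [x] on. *)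
Lemma walk_shortcut x p : walk x p -> exists q, [/\ walk x q,
    uniq (x :: [seq tgt e | e <- q]),
    last x [seq tgt e | e <- q] = last x [seq tgt e | e <- p]
  & {subset q <= p}].
Proof.
elim: p x => [|e p IHp] x /=; first by exists [::].
case/andP=> /eqP ex /IHp[q [wq uq lq sq]].
have sep : {subset q <= e :: p} by move=> e' /sq; rewrite inE => ->; rewrite orbT.
have [xq|xNq] := boolP (x \in tgt e :: [seq tgt e | e <- q]).
  have [q' [wq' uq' lq' sq']] := simple_walk_suffix wq uq xq.
  by exists q'; split=> //; [rewrite lq'|move=> e' /sq'/sep].
exists (e :: q); split=> //=; first by rewrite ex eqxx.
  by rewrite xNq.
by move=> e'; rewrite !inE => /predU1P[->|/sq->]; rewrite ?eqxx ?orbT.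
Qed.

Definition ends P := (path_start P, path_end P).
Definition arcs L := [seq ends P | P <- L].

(** Walks may repeat an edge, so their load is counted with multiplicity; for paths membership
    suffices, as in [flow_capacity]. *)
Lemma dipaths_of_walks L : all (fun P => walk P.1 P.2) L ->
  exists L', [/\ arcs L' = arcs L, all (@is_dipath N) L'
    & forall e, (\sum_(P <- L') (e \in P.2) <= \sum_(P <- L) count_mem e P.2)%N].
Proof.
elim: L => [|P L IHL] /=; first by exists [::]; split=> // e; rewrite !big_nil.
case/andP=> /walk_shortcut[q [wq uq lq sq]] /IHL[L' [aL dL cL]].
exists ((P.1, q) :: L'); split=> /=.
- by rewrite aL /ends /path_start /path_end /= lq.
- by rewrite dL /is_dipath wq uq.
move=> e; rewrite !big_cons leq_add //=.
by case: (boolP (e \in q)) => // /sq; rewrite -has_pred1 has_count.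
Qed.

(** The start of the splitting process: capacities become multiplicities, so out-degrees of
    [arcs unit_walks] are cut capacities. *)
Definition unit_walks : seq (npath N) :=
  flatten [seq nseq (capacity e) (src e, [:: e]) | e <- enum (edge N)].

Lemma count_unit_walks (a : pred (node N * node N)) :
  count a (arcs unit_walks) = (\sum_(e : edge N | a (src e, tgt e)) capacity e)%N.
Proof.
rewrite /arcs count_map /unit_walks count_flatten -map_comp sumnE big_map.
rewrite big_enum [RHS]big_mkcond /=; apply: eq_bigr => e _ /=.
by rewrite count_nseq /= /ends /=; case: (a _); rewrite ?mul1n ?mul0n.
Qed.

Lemma unit_walksP : all (fun P => walk P.1 P.2) unit_walks.
Proof.
apply/allP => P /flattenP[s /mapP[e _ ->]].
by rewrite mem_nseq => /andP[_ /eqP->] /=; rewrite eqxx.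
Qed.

Lemma unit_walks_capacity e :
  (\sum_(P <- unit_walks) count_mem e P.2 <= capacity e)%N.
Proof.
rewrite /unit_walks big_flatten big_map /= big_enum /= (bigD1 e) //=.
rewrite [X in (_ + X)%N]big1 => [|e' ee'].
  by rewrite addn0 big_nseq /= eqxx iter_addn addn0 mul1n.
by rewrite big_nseq /= (negPf ee') iter_addn addn0 mul0n.
Qed.

Lemma walk_exits U x p : walk x p -> x \in U ->
  last x [seq tgt e | e <- p] \notin U ->
  exists2 e, e \in p & leaves U (src e, tgt e).
Proof.
elim: p x => [|e p IHp] x /=; first by move=> _ ->.
case/andP=> /eqP ex wp xU lU; have [eU|eU] := boolP (tgt e \in U).
  by have [e' e'p lv] := IHp _ wp eU lU; exists e' => //; rewrite inE e'p orbT.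
by exists e; rewrite ?mem_head // /leaves /= ex xU.
Qed.

(** * Weak duality and integral multiflows *)

Section Flows.
Local Open Scope ring_scope.
Context {R : realType}.

(** Every path counted by [cut_value] has an edge leaving [U]; exchanging sums bounds its weight by
    the capacity of these edges. *)
Lemma cut_value_le (g : multiflow R N) X U : separates X U ->
  cut_value X g <= (outdeg (arcs unit_walks) U)%:R.
Proof.
move=> sU; rewrite /cut_value /outdeg count_unit_walks natr_sum.
apply: le_trans
  (_ : \sum_(e : edge N | leaves U (src e, tgt e))
         \sum_(P <- flow_paths g | e \in P.2) flow_val g P <= _); last first.
  by apply: ler_sum => e _; exact: flow_capacity.
rewrite (exchange_big_dep predT) //= big_seq [leRHS]big_seq.
apply: ler_sum => P Pg; rewrite sumr_const -[leRHS]mulr_natr.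
rewrite ler_wpM2l ?flow_val_ge0 // ler_nat /delta.
case: ifP => // /andP[sX tX]; have /and4P[/andP[wP _] _ _ _] := flow_pathsP Pg.
move/forallP: sU => sU.
have sPU : path_start P \in U by have /andP[/implyP/(_ sX)] := sU (path_start P).
have tPU : path_end P \notin U by have /andP[_ /implyP/(_ tX)] := sU (path_end P).
have [e eP le] := walk_exits wP sPU tPU.
by apply/card_gt0P; exists e; rewrite unfold_in /= le.
Qed.

Lemma sum_count_fset (T : choiceType) (s : seq T) (a : pred T) (f : T -> R) :
  \sum_(x <- [fset x in s]%fset | a x) (count_mem x s)%:R * f x =
  \sum_(x <- s | a x) f x.
Proof.
rewrite -[RHS]big_undup_iterop_count (perm_big (undup s)) /=; last first.
  apply: uniq_perm; rewrite ?undup_uniq ?fset_uniq // => x.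
  by rewrite mem_undup !inE.
apply: eq_bigr => x _; rewrite mulr_natl.
by elim: (count_mem x s) => [|[|n] IHn] //=; rewrite mulrS IHn.
Qed.

(** Each path carries its multiplicity in [L], which gives integrality. *)
Lemma multiflow_of_dipaths L : all (@joins_terminals N) L ->
  (forall e, (\sum_(P <- L) (e \in P.2) <= capacity e)%N) ->
  exists f : multiflow R N, integral f /\ forall X, cut_value X f =
    (count (fun a => (a.1 \in X.1) && (a.2 \in X.2)) (arcs L))%:R.
Proof.
move=> jL cL.
have pathsP P : P \in [fset P in L]%fset -> joins_terminals P.
  by rewrite !inE => /(allP jL).
have capP e : \sum_(P <- [fset P in L]%fset | e \in P.2) (count_mem P L)%:R
    <= (capacity e)%:R :> R.
  under eq_bigr do rewrite -[_%:R]mulr1.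
  rewrite (sum_count_fset L (fun P => e \in P.2) (fun=> 1)) big_mkcond /=.
  apply: le_trans (_ : (\sum_(P <- L) (e \in P.2))%:R <= _); last by rewrite ler_nat.
  by rewrite natr_sum; apply: ler_sum => P _; case: (e \in P.2).
exists (@Multiflow R N [fset P in L]%fset (fun P => (count_mem P L)%:R)
  pathsP (fun _ _ => ler0n _ _) capP); split; first by move=> P _; exact: natr_int.
move=> X; rewrite /cut_value /=.
rewrite (sum_count_fset L predT (fun P => (delta X (path_start P) (path_end P))%:R)).
rewrite -sum1_count big_map natr_sum [RHS]big_mkcond /=.
by apply: eq_bigr => P _; rewrite /delta; case: ifP.
Qed.
End Flows.

End Walks.

Lemma sub_in_count (T : eqType) (a b : pred T) (s : seq T) :
  {in s, subpred a b} -> (count a s <= count b s)%N.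
Proof.
move=> ab; rewrite (eq_in_count (a2 := predI a b)); last first.
  by move=> x xs /=; case: (boolP (a x)) => // /(ab _ xs) ->.
by apply: sub_count => x /andP[].
Qed.

(** * Splitting off as concatenation of walks *)

Section Reroutings.
Context {N : network} (F : {set cut_pair N}).
Implicit Types (P Q : npath N) (L : seq (npath N)) (v : node N)
  (U : {set node N}) (X : cut_pair N) (a : node N * node N).

Lemma separates_source X : [disjoint X.1 & X.2] -> separates X X.1.
Proof.
move=> dX; apply/forallP => x; rewrite implybb /=; apply/implyP => xX.
by rewrite (disjointFl dX).
Qed.

(** [X.1] is the candidate that [arg min] requires; it separates [X] when the sides are disjoint. *)
Definition mincut X : {set node N} :=
  [arg min_(U < X.1 | separates X U) outdeg (arcs unit_walks) U].

Definition connectivity X := outdeg (arcs unit_walks) (mincut X).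

Lemma mincutP X : [disjoint X.1 & X.2] -> separates X (mincut X) /\
  forall U, separates X U -> (connectivity X <= outdeg (arcs unit_walks) U)%N.
Proof.
by rewrite /connectivity /mincut => /separates_source sX; case: arg_minnP.
Qed.

(** The invariants of splitting. The third preserves out-degree minus in-degree, without
    subtraction; the last two together keep [mincut X] tight for [X] in [F]. *)
Definition rerouting L := [/\ all (fun P => walk P.1 P.2) L,
  forall e, (\sum_(P <- L) count_mem e P.2 <= capacity e)%N,
  forall v, (count (fun a => a.1 == v) (arcs L)
             + count (fun a => a.2 == v) (arcs unit_walks) =
             count (fun a => a.2 == v) (arcs L)
             + count (fun a => a.1 == v) (arcs unit_walks))%N,
  forall U, (outdeg (arcs L) U <= outdeg (arcs unit_walks) U)%N
& forall X U, X \in F -> separates X U ->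
    (connectivity X <= outdeg (arcs L) U)%N].

Lemma rerouting_perm L L' : perm_eq L L' -> rerouting L -> rerouting L'.
Proof.
move=> LL' [wL cL nL dL fL].
have aL : count^~ (arcs L) =1 count^~ (arcs L').
  by move=> b; apply/permP; exact: perm_map.
split.
- by rewrite -(perm_all _ LL').
- by move=> e; rewrite -(perm_big _ LL').
- by move=> v; have := nL v; rewrite !aL.
- by move=> U; have := dL U; rewrite /outdeg aL.
- by move=> X U XF sU; have := fL X U XF sU; rewrite /outdeg aL.
Qed.

Lemma rerouting_drop_loop P L : path_start P = path_end P ->
  rerouting (P :: L) -> rerouting L.
Proof.
move=> loop [/= /andP[_ wL] cL nL dL fL].
have out U : outdeg (arcs (P :: L)) U = outdeg (arcs L) U.
  by rewrite /outdeg /= /leaves /= loop andbN.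
split=> //.
- by move=> e; apply: leq_trans (cL e); rewrite big_cons leq_addl.
- by move=> v; have /= := nL v; rewrite loop; lia.
- by move=> U; rewrite -out dL.
- by move=> X U XF sU; rewrite -out fL.
Qed.

Definition concat P Q : npath N := (P.1, P.2 ++ Q.2).

Lemma ends_concat P Q : path_end P = path_start Q ->
  ends (concat P Q) = (path_start P, path_end Q).
Proof.
by rewrite /ends /path_start /path_end /= map_cat last_cat => ->.
Qed.

Lemma leaves_concat U P Q : path_end P = path_start Q ->
  (leaves U (ends P) + leaves U (ends Q) = leaves U (ends (concat P Q)) +
    ([&& path_start P \in U, path_end Q \in U & path_end P \notin U] ||
     [&& path_start P \notin U, path_end Q \notin U & path_end P \in U]))%N.
Proof.
move=> PQ; rewrite ends_concat // /leaves /= -PQ.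
by case: (path_start P \in U); case: (path_end P \in U); case: (path_end Q \in U).
Qed.

(** By [leaves_concat] an out-degree drops by one exactly when the set has the middle node on one
    side and both ends on the other, so only a tight set of this kind can obstruct. *)
Lemma rerouting_split P Q L : path_end P = path_start Q ->
  rerouting [:: P, Q & L] ->
  rerouting (concat P Q :: L) \/ exists X U, [/\ X \in F,
    tight (arcs [:: P, Q & L]) connectivity X U
  & [&& path_start P \in U, path_end Q \in U & path_end P \notin U] ||
    [&& path_start P \notin U, path_end Q \notin U & path_end P \in U]].
Proof.
move=> PQ [/= /and3P[wP wQ wL] cL nL dL fL].
have [|nblocked] := pselect (exists X U, [/\ X \in F,
    tight (arcs [:: P, Q & L]) connectivity X U
  & [&& path_start P \in U, path_end Q \in U & path_end P \notin U] ||
    [&& path_start P \notin U, path_end Q \notin U & path_end P \in U]]).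
  by right.
left; split=> /=.
- rewrite wL andbT walk_cat wP /=.
  by move: PQ; rewrite /path_end /path_start => ->.
- by move=> e; have := cL e; rewrite !big_cons /= count_cat addnA.
- by move=> v; have /= := nL v; have [->] := ends_concat PQ; rewrite PQ /path_start; lia.
- move=> U; apply: leq_trans (dL U); rewrite /outdeg /=.
  by rewrite addnA leaves_concat // addnAC leq_addr.
- move=> X U XF sU; have := fL X U XF sU.
  rewrite /outdeg /= addnA leaves_concat //.
  case: (boolP (_ || _)) => [bl|_]; last by rewrite addn0.
  rewrite addnAC addn1 leq_eqVlt ltnS => /orP[/eqP tU|//].
  case: nblocked; exists X, U; split=> //.
  by rewrite /tight sU /outdeg /= addnA leaves_concat // bl addnAC addn1 tU /=.
Qed.

Lemma rerouting_unit_walks : (forall X, X \in F -> [disjoint X.1 & X.2]) ->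
  rerouting unit_walks.
Proof.
move=> dF; split=> //; [exact: unit_walksP|exact: unit_walks_capacity| |].
  by move=> v; rewrite addnC.
by move=> X U XF; case: (mincutP (dF X XF)) => _; apply.
Qed.

(** Replaces iterated splitting: both a split and the removal of a loop reduce the number of
    walks. *)
Lemma minimal_rerouting : (forall X, X \in F -> [disjoint X.1 & X.2]) ->
  exists L, rerouting L /\ forall L', rerouting L' -> (size L <= size L')%N.
Proof.
move=> /rerouting_unit_walks r0.
pose P n := `[< exists L, rerouting L /\ size L = n >].
have exP : exists n, P n.
  by exists (size (@unit_walks N)); apply/asboolP; exists unit_walks.
case: (ex_minnP exP) => n /asboolP[L [rL <-]] minL.
by exists L; split=> // L' rL'; apply: minL; apply/asboolP; exists L'.
Qed.

Lemma minimal_unsplittable L : rerouting L ->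
  (forall L', rerouting L' -> (size L <= size L')%N) ->
  forall u v w, (u, v) \in arcs L -> (v, w) \in arcs L ->
  exists X U, [/\ X \in F, tight (arcs L) connectivity X U
    & [&& u \in U, w \in U & v \notin U] || [&& u \notin U, w \notin U & v \in U]].
Proof.
move=> rL minL.
have loopless P : P \in L -> path_start P != path_end P.
  move=> PL; apply/eqP => loop.
  have := rerouting_drop_loop loop (rerouting_perm (perm_to_rem PL) rL).
  by move/minL; rewrite (perm_size (perm_to_rem PL)) ltnn.
move=> u v w /mapP[P PL [-> vP]] /mapP[Q QL [vQ ->]].
have PQ : path_end P = path_start Q by rewrite -vP.
(* [P] and [Q] must be separate entries of [L]; were they the same walk, it would be a loop. *)
have QP : Q \in rem P L.
  have: Q \in P :: rem P L by rewrite -(perm_mem (perm_to_rem PL)).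
  rewrite inE => /predU1P[QP|//].
  by have := loopless P PL; rewrite PQ QP eqxx.
have pL : perm_eq L [:: P, Q & rem Q (rem P L)].
  by rewrite (perm_trans (perm_to_rem PL)) // perm_cons perm_to_rem.
case: (rerouting_split PQ (rerouting_perm pL rL)) => [/minL|[X [U [XF tU bl]]]].
  by rewrite (perm_size pL) /= ltnn.
exists X, U; split=> //; last by rewrite vP.
move: tU; rewrite /tight /outdeg; congr (_ && (_ == _)).
by apply/permP; apply: perm_map; rewrite perm_sym.
Qed.

End Reroutings.

(** * The locking multiflow from a shortest rerouting *)

Local Open Scope ring_scope.

Theorem theorem3p5 (R : realType) (N : network) (F : {set cut_pair N})
    (hcut : forall X, X \in F -> partial_cut X)
    (hlam : laminar_family F)
    (hinner : inner_eulerian N)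
    (hterm : forall s : node N, s \in terminals N ->
       (exists X Y : cut_pair N,
          [/\ X \in F, Y \in F,
              s \notin X.1 :|: X.2 :|: Y.1 :|: Y.2
            & (X.1 \subset Y.2 /\ Y.1 \subset X.2) \/
              (X.2 \subset Y.1 /\ Y.2 \subset X.1)]) ->
       eulerian_at s) :
  exists f : multiflow R N, integral f /\ locks f F.
Proof.
have dF X : X \in F -> [disjoint X.1 & X.2] by case/hcut.
have [L [rL minL]] := minimal_rerouting dF.
have unsplit := minimal_unsplittable rL minL.
have [wL cL nL dL fL] := rL.
have bal X Y v : X \in F -> Y \in F ->
    X.1 \subset Y.2 /\ Y.1 \subset X.2 \/ X.2 \subset Y.1 /\ Y.2 \subset X.1 ->
    v \notin X.1 :|: X.2 :|: Y.1 :|: Y.2 -> balanced (arcs L) v.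
  move=> XF YF fXY vN; have eul : eulerian_at v.
    have [vT|/hinner//] := boolP (v \in terminals N).
    by apply: hterm => //; exists X, Y.
  have := nL v; rewrite !count_unit_walks /= eul => nv; apply/eqP; lia.
have source := tight_source fL hlam bal unsplit.
have sink := tight_sink fL hlam bal unsplit.
(* Walks not joining distinct terminals are discarded; none of them leaves a minimum cut of a member
   of [F]. *)
pose joins (P : npath N) := [&& path_start P \in terminals N,
  path_end P \in terminals N & path_start P != path_end P].
have wJ : all (fun P : npath N => walk P.1 P.2) [seq P <- L | joins P].
  by apply/allP => P; rewrite mem_filter => /andP[_ /(allP wL)].
have [L' [aL' dL' cL']] := dipaths_of_walks wJ.
have jL' : all (@joins_terminals N) L'.
  apply/allP => P PL'; rewrite /joins_terminals (allP dL' _ PL') /=.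
  have: ends P \in arcs L' by apply: map_f.
  rewrite aL' => /mapP[Q]; rewrite mem_filter => /andP[jQ _] [sP tP].
  by rewrite sP tP.
have capL' e : (\sum_(P <- L') (e \in P.2) <= capacity e)%N.
  apply: leq_trans (cL' e) (leq_trans _ (cL e)).
  by rewrite big_filter big_mkcond /=; apply: leq_sum => P _; case: ifP.
have [f [intf valf]] := multiflow_of_dipaths (R := R) jL' capL'.
exists f; split=> // X XF g.
have [sX _] := mincutP (dF X XF).
apply: le_trans (cut_value_le g sX) _; rewrite valf ler_nat.
have tX : tight (arcs L) connectivity X (mincut X).
  by rewrite /tight sX eqn_leq dL fL.
(* The cut bound on [g] is [connectivity X], at most the number of arcs of [L] leaving [mincut X];
   by [source] and [sink] each of these goes from [X.1] to [X.2], so its walk was kept. *)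
apply: leq_trans (fL X _ XF sX) _; rewrite aL'.
rewrite /outdeg !count_map count_filter; apply: sub_in_count => P PL /= lv.
have aP : ends P \in arcs L by apply: map_f.
case/andP: lv => sU tU.
have sA := source _ _ _ _ XF tX sU tU aP; have tB := sink _ _ _ _ XF tX sU tU aP.
have [/subsetP AT /subsetP BT _] := hcut _ XF.
rewrite sA tB /joins AT // BT //=; apply/eqP => sP.
by move: tB; rewrite /= -sP (disjointFr (dF X XF) sA).
Qed.
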